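(* Let $\mathcal{C}$ be a semisimple multiring category over $\Bbbk$ with left duals, with unit decomposition $1=\oplus_{i\in I}1_i$, and let $(A,m_A,u_A)$ be an algebra in $\mathcal{C}$. Let $J=\{i\in I\mid A_{ii}\neq 0\}$. Then the functor $-\otimes A_J:\mathcal{C}_J\to(\mathcal{C}_J)_{A_J}$ is separable.
   Context: $\Bbbk$ is an algebraically closed field; monoidal categories are assumed strict, with tensor product $\otimes$ and unit object $1$. A multiring category over $\Bbbk$ is a locally finite (finite-dimensional Hom spaces, all objects of finite length) $\Bbbk$-linear abelian monoidal category with bilinear and biexact tensor product. ''With left duals'' means every object has a left dual. An abelian category is semisimple if every object is a direct sum of simple objects. For such $\mathcal{C}$ the unit object is a finite direct sum $1=\oplus_{i\in I}1_i$ of pairwise non-isomorphic simple objects $1_i$ (the images of the primitive idempotents of $\mathrm{End}(1)$), $1_i\otimes 1_j=0$ for $i\neq j$, and $\mathcal{C}=\oplus_{i,j\in I}\mathcal{C}_{ij}$ with $\mathcal{C}_{ij}=1_i\otimes\mathcal{C}\otimes 1_j$. For an object $X$, $X_{ij}=1_i\otimes X\otimes 1_j$. For $J\subseteq I$: $\mathcal{C}_J:=\oplus_{i,j\in J}\mathcal{C}_{ij}$ (full subcategory of $\mathcal{C}$), $1_J:=\oplus_{i\in J}1_i$, and $p_J:1\to 1_J$, $i_J:1_J\to 1$ are the canonical projection and inclusion (for $J=\emptyset$ empty direct sums are zero). $\mathcal{C}_J$ is monoidal with the tensor product of $\mathcal{C}$, unit object $1_J$, and unit constraints $l^J_X=i_J\otimes\mathrm{Id}_X$,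 $r^J_X=\mathrm{Id}_X\otimes i_J$. $A_J:=1_J\otimes A\otimes 1_J$ is an algebra in $\mathcal{C}_J$ with multiplication $(\mathrm{Id}_{1_J}\otimes m_A\otimes\mathrm{Id}_{1_J})(\mathrm{Id}_{1_J\otimes A}\otimes i_J\otimes i_J\otimes\mathrm{Id}_{A\otimes 1_J})$ and unit $(\mathrm{Id}_{1_J}\otimes u_A\otimes\mathrm{Id}_{1_J})(\mathrm{Id}_{1_J}\otimes\mathrm{Id}_1\otimes p_J):1_J\to A_J$. For an algebra $B$ in a monoidal category $\mathcal{E}$, $\mathcal{E}_B$ is the category of right $B$-modules and $-\otimes B:\mathcal{E}\to\mathcal{E}_B$ is $M\mapsto(M\otimes B,M\otimes m_B)$, $f\mapsto f\otimes B$. A functor $F:\mathcal{E}\to\mathcal{D}$ is separable if there is a natural transformation $\mathcal{P}:\mathrm{Hom}_{\mathcal{D}}(F-,F-)\to\mathrm{Hom}_{\mathcal{E}}(-,-)$ with $\mathcal{P}(F(f))=f$ for every morphism $f$ in $\mathcal{E}$. *)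

(* Defs.v *)
From HB Require Import structures.
From mathcomp Require Import all_boot all_order all_algebra.
From mathcomp Require Import boolp.

Set Implicit Arguments.
Unset Strict Implicit.
Unset Printing Implicit Defensive.

Import GRing.Theory.
Local Open Scope ring_scope.

Declare Scope cat_scope.
Delimit Scope cat_scope with cat.
Local Open Scope cat_scope.

Record category := Category {
  ob :> Type;
  hom : ob -> ob -> Type;
  idm : forall X, hom X X;
  comp : forall X Y Z, hom Y Z -> hom X Y -> hom X Z;
  compA : forall X Y Z W (h : hom Z W) (g : hom Y Z) (f : hom X Y),
    comp h (comp g f) = comp (comp h g) f;
  comp1m : forall X Y (f : hom X Y), comp (idm Y) f = f;
  compm1 : forall X Y (f : hom X Y), comp f (idm X) = f }.

Arguments hom {c} X Y.
Arguments idm {c} X.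
Arguments comp {c X Y Z} g f.

Notation "g \oc f" := (comp g f) (at level 50, left associativity) : cat_scope.

Definition is_iso (C : category) (X Y : C) (f : hom X Y) : Prop :=
  exists g : hom Y X, g \oc f = idm X /\ f \oc g = idm Y.

Definition mono (C : category) (X Y : C) (f : hom X Y) : Prop :=
  forall Z (g h : hom Z X), f \oc g = f \oc h -> g = h.

Definition epi (C : category) (X Y : C) (f : hom X Y) : Prop :=
  forall Z (g h : hom Y Z), g \oc f = h \oc f -> g = h.

(* The identity of [X], seen as a morphism to the equal object [Y]. *)
Definition cast (C : category) (X Y : C) (e : X = Y) : hom X Y :=
  let: erefl := e in idm X.

Record functor (C D : category) := Functor {
  fob :> C -> D;
  fmap : forall X Y, hom X Y -> hom (fob X) (fob Y);
  fmap1 : forall X, fmap (idm X) = idm (fob X);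
  fmapM : forall X Y Z (g : hom Y Z) (f : hom X Y),
    fmap (g \oc f) = fmap g \oc fmap f }.

Arguments fmap {C D} F {X Y} f : rename.

Definition separable (C D : category) (F : functor C D) : Prop :=
  exists P : forall X Y : C, hom (F X) (F Y) -> hom X Y,
    (forall (X X' Y Y' : C) (f : hom X' X) (h : hom (F X) (F Y)) (g : hom Y Y'),
        P X' Y' (fmap F g \oc h \oc fmap F f) = g \oc P X Y h \oc f)
    /\ (forall (X Y : C) (f : hom X Y), P X Y (fmap F f) = f).

Section FullSubcategory.
Variables (C : category) (S : C -> Prop).

Definition full_subcategory : category :=
  @Category {X : C | S X} (fun X Y => hom (sval X) (sval Y))
    (fun X => idm (sval X)) (fun X Y Z g f => g \oc f)
    (fun X Y Z W h g f => compA h g f)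
    (fun X Y f => comp1m f) (fun X Y f => compm1 f).

End FullSubcategory.

Record monoidal_structure (C : category) := MonoidalStructure {
  tens : C -> C -> C;
  tensm : forall X Y X' Y' : C,
    hom X Y -> hom X' Y' -> hom (tens X X') (tens Y Y');
  unit : C;
  assoc : forall X Y Z, hom (tens (tens X Y) Z) (tens X (tens Y Z));
  assocV : forall X Y Z, hom (tens X (tens Y Z)) (tens (tens X Y) Z);
  lunit : forall X, hom (tens unit X) X;
  lunitV : forall X, hom X (tens unit X);
  runit : forall X, hom (tens X unit) X;
  runitV : forall X, hom X (tens X unit);
  tensm1 : forall X Y, tensm (idm X) (idm Y) = idm (tens X Y);
  tensmM : forall X Y Z X' Y' Z' (g : hom Y Z) (f : hom X Y)
      (g' : hom Y' Z') (f' : hom X' Y'),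
    tensm (g \oc f) (g' \oc f') = tensm g g' \oc tensm f f';
  assocVK : forall X Y Z, assoc X Y Z \oc assocV X Y Z = idm _;
  assocKV : forall X Y Z, assocV X Y Z \oc assoc X Y Z = idm _;
  lunitVK : forall X, lunit X \oc lunitV X = idm _;
  lunitKV : forall X, lunitV X \oc lunit X = idm _;
  runitVK : forall X, runit X \oc runitV X = idm _;
  runitKV : forall X, runitV X \oc runit X = idm _;
  assoc_nat : forall X X' Y Y' Z Z' (f : hom X X') (g : hom Y Y') (h : hom Z Z'),
    assoc X' Y' Z' \oc tensm (tensm f g) h = tensm f (tensm g h) \oc assoc X Y Z;
  lunit_nat : forall X Y (f : hom X Y),
    lunit Y \oc tensm (idm unit) f = f \oc lunit X;
  runit_nat : forall X Y (f : hom X Y),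
    runit Y \oc tensm f (idm unit) = f \oc runit X;
  pentagon : forall X Y Z W,
    assoc X Y (tens Z W) \oc assoc (tens X Y) Z W
    = tensm (idm X) (assoc Y Z W) \oc assoc X (tens Y Z) W
        \oc tensm (assoc X Y Z) (idm W);
  triangle : forall X Y,
    tensm (idm X) (lunit Y) \oc assoc X unit Y = tensm (runit X) (idm Y) }.

Record monoidal_category := MonoidalCategory {
  mcat :> category;
  mstr : monoidal_structure mcat }.

Notation "X \ox Y" := (tens (mstr _) X Y)
  (at level 40, left associativity) : cat_scope.
Notation "f \om g" := (tensm (mstr _) f g)
  (at level 40, left associativity) : cat_scope.
Notation "\1" := (unit (mstr _)) (at level 0) : cat_scope.
Notation "\a_ ( X , Y , Z )" := (assoc (mstr _) X Y Z)
  (at level 0, format "\a_ ( X ,  Y ,  Z )") : cat_scope.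
Notation "\l_ X" := (lunit (mstr _) X) (at level 8, X at level 2) : cat_scope.
Notation "\r_ X" := (runit (mstr _) X) (at level 8, X at level 2) : cat_scope.

(* The associators and unitors are identities. *)
Record strict (C : monoidal_category) : Prop := Strict {
  tensA : forall X Y Z : C, (X \ox Y) \ox Z = X \ox (Y \ox Z);
  tens1X : forall X : C, \1 \ox X = X;
  tensX1 : forall X : C, X \ox \1 = X;
  assocE : forall X Y Z : C, \a_(X, Y, Z) = cast (tensA X Y Z);
  lunitE : forall X : C, \l_X = cast (tens1X X);
  runitE : forall X : C, \r_X = cast (tensX1 X) }.

(* [Y] is a left dual of [X]: [(X \ox ev) (coev \ox X) = X] and
   [(ev \ox Y) (Y \ox coev) = Y], up to the constraints. *)
Definition is_left_dual (C : monoidal_category) (X Y : C) : Prop :=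
  exists (ev : hom (Y \ox X) \1) (coev : hom \1 (X \ox Y)),
    \r_X \oc (idm X \om ev) \oc \a_(X, Y, X)
      \oc (coev \om idm X) \oc lunitV (mstr C) X = idm X
    /\ \l_Y \oc (ev \om idm Y) \oc assocV (mstr C) Y X Y
         \oc (idm Y \om coev) \oc runitV (mstr C) Y = idm Y.

Definition has_left_duals (C : monoidal_category) : Prop :=
  forall X : C, exists Y : C, is_left_dual X Y.

Record algebra (C : monoidal_category) := Algebra {
  alg_ob :> C;
  alg_mul : hom (alg_ob \ox alg_ob) alg_ob;
  alg_unit : hom \1 alg_ob;
  alg_mulA : alg_mul \oc (alg_mul \om idm alg_ob)
    = alg_mul \oc (idm alg_ob \om alg_mul) \oc \a_(alg_ob, alg_ob, alg_ob);
  alg_mul1m : alg_mul \oc (alg_unit \om idm alg_ob) = \l_(alg_ob);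
  alg_mulm1 : alg_mul \oc (idm alg_ob \om alg_unit) = \r_(alg_ob) }.

Section Modules.
Variables (C : monoidal_category) (B : algebra C).

Record right_module := RightModule {
  mod_ob :> C;
  act : hom (mod_ob \ox B) mod_ob;
  actA : act \oc (act \om idm B)
    = act \oc (idm mod_ob \om alg_mul B) \oc \a_(mod_ob, alg_ob B, alg_ob B);
  act1 : act \oc (idm mod_ob \om alg_unit B) = \r_mod_ob }.

Definition module_hom (M N : right_module) : Type :=
  {f : hom (M : C) N | f \oc act M = act N \oc (f \om idm B)}.

Lemma module_hom_eq (M N : right_module) (f g : module_hom M N) :
  sval f = sval g -> f = g.
Proof.
case: f g => [f pf] [g pg] /= efg; subst g.
by rewrite (Prop_irrelevance pf pg).
Qed.

Lemma module_id_subproof (M : right_module) :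
  idm (M : C) \oc act M = act M \oc (idm (M : C) \om idm (B : C)).
Proof. by rewrite tensm1 compm1 comp1m. Qed.

Lemma module_comp_subproof (M N P : right_module)
    (g : module_hom N P) (f : module_hom M N) :
  (sval g \oc sval f) \oc act M = act P \oc ((sval g \oc sval f) \om idm (B : C)).
Proof.
rewrite -compA (svalP f) compA (svalP g) -compA -tensmM.
by rewrite comp1m.
Qed.

Definition modules : category.
Proof.
refine (@Category right_module module_hom
  (fun M => exist _ (idm (M : C)) (module_id_subproof M))
  (fun M N P g f => exist _ (sval g \oc sval f) (module_comp_subproof g f))
  _ _ _).
- by move=> X Y Z W h g f; apply: module_hom_eq; apply: compA.
- by move=> X Y f; apply: module_hom_eq; apply: comp1m.
- by move=> X Y f; apply: module_hom_eq; apply: compm1.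
Defined.

End Modules.

Section Coherence.
Variable C : monoidal_category.
Implicit Types X Y Z : C.

Lemma iso_mono X Y (f : hom X Y) : is_iso f -> mono f.
Proof.
case=> g [gf _] Z h1 h2 /(congr1 (comp g)).
by rewrite !compA gf !comp1m.
Qed.

Lemma iso_epi X Y (f : hom X Y) : is_iso f -> epi f.
Proof.
case=> g [_ fg] Z h1 h2 /(congr1 (fun h => h \oc g)).
by rewrite -!compA fg !compm1.
Qed.

Lemma assoc_iso X Y Z : is_iso \a_(X, Y, Z).
Proof. by exists (assocV (mstr C) X Y Z); rewrite assocVK assocKV. Qed.

Lemma runit_iso X : is_iso \r_X.
Proof. by exists (runitV (mstr C) X); rewrite runitVK runitKV. Qed.

Lemma tensmX1_inj X Y (f g : hom X Y) :
  f \om idm \1 = g \om idm \1 -> f = g.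
Proof.
move=> efg; apply: (iso_epi (runit_iso X)).
by rewrite -!runit_nat efg.
Qed.

Lemma tensmDl X Y Z (W : C) (g : hom Y Z) (f : hom X Y) :
  (g \oc f) \om idm W = (g \om idm W) \oc (f \om idm W).
Proof. by rewrite -tensmM comp1m. Qed.

Lemma tensmDr X Y Z (W : C) (g : hom Y Z) (f : hom X Y) :
  idm W \om (g \oc f) = (idm W \om g) \oc (idm W \om f).
Proof. by rewrite -tensmM comp1m. Qed.

Lemma runit_tens X Y : (idm X \om \r_Y) \oc \a_(X, Y, \1) = \r_(X \ox Y).
Proof.
apply: tensmX1_inj.
apply: (iso_mono (assoc_iso X Y \1)).
rewrite tensmDl compA assoc_nat -!triangle tensmDr -!compA.
rewrite (compA (idm X \om \a_(Y, \1, \1))) -pentagon !compA; congr (_ \oc _).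
by rewrite -assoc_nat tensm1.
Qed.

End Coherence.

Section FreeModules.
Variables (C : monoidal_category) (B : algebra C).

Lemma free_actA (M : C) (x := (idm M \om alg_mul B) \oc \a_(M, alg_ob B, alg_ob B)) :
  x \oc (x \om idm (B : C))
  = x \oc (idm (M \ox B) \om alg_mul B) \oc \a_(M \ox B, alg_ob B, alg_ob B).
Proof.
rewrite /x tensmDl compA -[in LHS](compA _ \a_(_, _, _)) assoc_nat.
rewrite -tensm1 -[in RHS](compA _ \a_(_, _, _)) assoc_nat !compA -!tensmM !comp1m.
rewrite alg_mulA -[in RHS]compA pentagon !compA -!tensmM !comp1m.
by [].
Qed.

Lemma free_act1 (M : C) :
  (idm M \om alg_mul B) \oc \a_(M, alg_ob B, alg_ob B)
    \oc (idm (M \ox B) \om alg_unit B) = \r_(M \ox B).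
Proof.
by rewrite -tensm1 -compA assoc_nat compA -tensmM comp1m alg_mulm1 runit_tens.
Qed.

Definition free_module (M : C) : right_module B :=
  RightModule (free_actA M) (free_act1 M).

Lemma free_map_subproof (M N : C) (f : hom M N) :
  (f \om idm (B : C)) \oc act (free_module M)
  = act (free_module N) \oc ((f \om idm (B : C)) \om idm (B : C)).
Proof.
by rewrite /= -compA assoc_nat tensm1 !compA -!tensmM !(comp1m, compm1).
Qed.

Definition free_map (M N : C) (f : hom M N) :
    @hom (modules B) (free_module M) (free_module N) :=
  exist _ (f \om idm (B : C)) (free_map_subproof f).

Definition free_module_functor : functor C (modules B).
Proof.
refine (@Functor C (modules B) free_module free_map _ _).
- by move=> M; apply: module_hom_eq; rewrite /= tensm1.
- by move=> M N P g f; apply: module_hom_eq; rewrite /= -tensmM comp1m.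
Defined.

End FreeModules.

(* Two morphisms with provably equal ends are compared as elements of the total
   type of morphisms. *)
Definition arrow (C : category) : Type := {X : C & {Y : C & hom X Y}}.

Definition arr (C : category) (X Y : C) (f : hom X Y) : arrow C :=
  existT _ X (existT _ Y f).

Section Arrows.
Variable C : category.
Implicit Types X Y Z : C.

Lemma arr_inj X Y (f g : hom X Y) : arr f = arr g -> f = g.
Proof.
have cast_id (P : C -> Type) Z (e : Z = Z) (x : P Z) : eq_rect Z P x Z e = x.
  by rewrite (Prop_irrelevance e (erefl Z)).
move=> /eq_sigT_uncurried_iff [/= p]; rewrite cast_id => {p}.
by move=> /eq_sigT_uncurried_iff [/= p]; rewrite cast_id.
Qed.

Lemma arr_comp X Y Z X' Y' Z' (g : hom Y Z) (f : hom X Y)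
    (g' : hom Y' Z') (f' : hom X' Y') :
  arr g = arr g' -> arr f = arr f' -> arr (g \oc f) = arr (g' \oc f').
Proof.
move=> eg; have eY : Y = Y' by case: eg.
have eZ : Z = Z' by case: eg.
subst Y' Z'; move: eg => /arr_inj <- ef.
have eX : X = X' by case: ef.
by subst X'; move: ef => /arr_inj <-.
Qed.

Lemma arr_castl X Y Z (e : Y = Z) (f : hom X Y) : arr (cast e \oc f) = arr f.
Proof. by subst Z; rewrite /= comp1m. Qed.

Lemma arr_castr X Y Z (e : X = Y) (f : hom Y Z) : arr (f \oc cast e) = arr f.
Proof. by subst Y; rewrite /= compm1. Qed.

Lemma arr_cast X Y (e : X = Y) : arr (cast e) = arr (idm X).
Proof. by subst Y. Qed.

End Arrows.

Section StrictCalculus.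
Variables (C : monoidal_category) (sC : strict C).
Implicit Types X Y Z : C.

Definition atens (a b : arrow C) : arrow C :=
  arr (projT2 (projT2 a) \om projT2 (projT2 b)).

Lemma arr_tens X Y X' Y' (f : hom X Y) (g : hom X' Y') :
  arr (f \om g) = atens (arr f) (arr g).
Proof. by []. Qed.

Lemma arr_assocl X Y Z W (f : hom W _) : arr (\a_(X, Y, Z) \oc f) = arr f.
Proof. by rewrite (assocE sC) arr_castl. Qed.

Lemma arr_assocr X Y Z W (f : hom _ W) : arr (f \oc \a_(X, Y, Z)) = arr f.
Proof. by rewrite (assocE sC) arr_castr. Qed.

Lemma arr_lunitl X W (f : hom W _) : arr (\l_X \oc f) = arr f.
Proof. by rewrite (lunitE sC) arr_castl. Qed.

Lemma arr_lunitr X W (f : hom _ W) : arr (f \oc \l_X) = arr f.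
Proof. by rewrite (lunitE sC) arr_castr. Qed.

Lemma arr_runitl X W (f : hom W _) : arr (\r_X \oc f) = arr f.
Proof. by rewrite (runitE sC) arr_castl. Qed.

Lemma arr_runitr X W (f : hom _ W) : arr (f \oc \r_X) = arr f.
Proof. by rewrite (runitE sC) arr_castr. Qed.

Lemma atensA : associative atens.
Proof.
move=> [X [X' f]] [Y [Y' g]] [Z [Z' h]]; rewrite /atens /=.
rewrite -(arr_assocr (f \om (g \om h))) -assoc_nat.
by rewrite arr_assocl.
Qed.

Lemma atens1x : left_id (arr (idm \1)) atens.
Proof.
by move=> [X [Y f]]; rewrite /atens /= -arr_lunitl lunit_nat arr_lunitr.
Qed.

Lemma atensx1 : right_id (arr (idm \1)) atens.
Proof.
by move=> [X [Y f]]; rewrite /atens /= -arr_runitl runit_nat arr_runitr.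
Qed.

Lemma arr_idm_tens X Y : arr (idm (X \ox Y)) = atens (arr (idm X)) (arr (idm Y)).
Proof. by rewrite -arr_tens tensm1. Qed.

End StrictCalculus.

Record linear_category (k : fieldType) := LinearCategory {
  lob : Type;
  lhom : lob -> lob -> vectType k;
  lidm : forall X, lhom X X;
  lcomp : forall X Y Z, lhom Y Z -> lhom X Y -> lhom X Z;
  lcompA : forall X Y Z W (h : lhom Z W) (g : lhom Y Z) (f : lhom X Y),
    lcomp h (lcomp g f) = lcomp (lcomp h g) f;
  lcomp1m : forall X Y (f : lhom X Y), lcomp (lidm Y) f = f;
  lcompm1 : forall X Y (f : lhom X Y), lcomp f (lidm X) = f;
  lcomp_linearl : forall X Y Z (f : lhom X Y),
    linear (fun g : lhom Y Z => lcomp g f);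
  lcomp_linearr : forall X Y Z (g : lhom Y Z),
    linear (fun f : lhom X Y => lcomp g f) }.

Definition category_of_linear (k : fieldType) (C : linear_category k) : category :=
  Category (@lcompA k C) (@lcomp1m k C) (@lcompm1 k C).

Coercion category_of_linear : linear_category >-> category.

Arguments hom : simpl never.
Arguments idm : simpl never.
Arguments comp : simpl never.
Arguments tens : simpl never.
Arguments tensm : simpl never.

Section LinearNotions.
Variables (k : fieldType) (C : linear_category k).
Implicit Types X Y Z S : C.

Definition zero_object Z : Prop :=
  (forall X (f : hom Z X), f = 0) /\ (forall X (f : hom X Z), f = 0).

(* [S] is the direct sum of the finite family [X]. *)
Record biproduct (K : finType) (X : K -> C) (S : C) := Biproduct {
  bin : forall i, hom (X i) S;
  bpr : forall i, hom S (X i);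
  bprK : forall i, bpr i \oc bin i = idm (X i);
  bpr0 : forall i j, i != j -> bpr j \oc bin i = 0;
  bsum : \sum_i (bin i \oc bpr i : hom S S) = idm S }.

Definition is_kernel X Y Z (g : hom Y Z) (f : hom X Y) : Prop :=
  g \oc f = 0 /\
  forall W (h : hom W Y), g \oc h = 0 -> exists! u : hom W X, f \oc u = h.

Definition is_cokernel X Y Z (f : hom X Y) (g : hom Y Z) : Prop :=
  g \oc f = 0 /\
  forall W (h : hom Y W), h \oc f = 0 -> exists! u : hom Z W, u \oc g = h.

Record abelian : Prop := Abelian {
  ab_zero : exists Z, zero_object Z;
  ab_biproduct : forall X Y,
    exists S, inhabited (biproduct (fun b : bool => if b then X else Y) S);
  ab_kernel : forall Y Z (g : hom Y Z), exists X (f : hom X Y), is_kernel g f;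
  ab_cokernel : forall X Y (f : hom X Y), exists Z (g : hom Y Z), is_cokernel f g;
  ab_mono : forall X Y (f : hom X Y), mono f ->
    exists Z (g : hom Y Z), is_kernel g f;
  ab_epi : forall Y Z (g : hom Y Z), epi g ->
    exists X (f : hom X Y), is_cokernel f g }.

Definition short_exact X Y Z (f : hom X Y) (g : hom Y Z) : Prop :=
  is_kernel g f /\ is_cokernel f g.

Definition simple X : Prop :=
  ~ zero_object X /\
  forall Y (f : hom Y X), mono f -> zero_object Y \/ is_iso f.

(* Existence of a composition series. *)
Inductive finite_length : C -> Prop :=
| finite_length0 X : zero_object X -> finite_length X
| finite_lengthS X Y Z (f : hom X Y) (g : hom Y Z) :
    short_exact f g -> finite_length X -> simple Z -> finite_length Y.

Definition semisimple : Prop :=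
  forall X, exists (n : nat) (S : 'I_n -> C),
    (forall i, simple (S i)) /\ inhabited (biproduct S X).

End LinearNotions.

Record linear_monoidal_category (k : fieldType) := LinearMonoidalCategory {
  lm_linear :> linear_category k;
  lm_monoidal : monoidal_structure lm_linear }.

Definition monoidal_of_linear (k : fieldType) (C : linear_monoidal_category k) :
  monoidal_category := MonoidalCategory (lm_monoidal C).

Coercion monoidal_of_linear : linear_monoidal_category >-> monoidal_category.

Canonical monoidal_of_linear.

(* Finite dimensionality of the morphism spaces is part of [linear_category]. *)
Record multiring_category (k : fieldType) := MultiringCategory {
  mr_cat :> linear_monoidal_category k;
  mr_strict : strict mr_cat;
  mr_abelian : abelian mr_cat;
  mr_finite_length : forall X : mr_cat, finite_length X;
  mr_tens_linearl : forall (X Y X' Y' : mr_cat) (g : hom X' Y'),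
    linear (fun f : hom X Y => (f \om g : hom (X \ox X') (Y \ox Y')));
  mr_tens_linearr : forall (X Y X' Y' : mr_cat) (f : hom X Y),
    linear (fun g : hom X' Y' => (f \om g : hom (X \ox X') (Y \ox Y')));
  mr_exactl : forall (W X Y Z : mr_cat) (f : hom X Y) (g : hom Y Z),
    short_exact f g -> short_exact (idm W \om f) (idm W \om g);
  mr_exactr : forall (W X Y Z : mr_cat) (f : hom X Y) (g : hom Y Z),
    short_exact f g -> short_exact (f \om idm W) (g \om idm W) }.

Section Bilinearity.
Variables (k : fieldType) (C : multiring_category k).
Implicit Types X Y Z : C.

Lemma linear_bigsum (U V : vectType k) (h : U -> V) (K : finType) (g : K -> U) :
  linear h -> h (\sum_i g i) = \sum_i h (g i).
Proof.
move=> lin.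
pose hl := GRing.isLinear.Build _ _ _ _ _ lin.
pose h' : {linear U -> V} := HB.pack h hl.
exact: (raddf_sum h').
Qed.

Lemma comp_suml X Y Z (K : finType) (g : K -> hom Y Z) (f : hom X Y) :
  (\sum_i g i : hom Y Z) \oc f = \sum_i (g i \oc f : hom X Z).
Proof. exact: (linear_bigsum g (@lcomp_linearl k C X Y Z f)). Qed.

Lemma comp_sumr X Y Z (K : finType) (g : hom Y Z) (f : K -> hom X Y) :
  g \oc (\sum_i f i : hom X Y) = \sum_i (g \oc f i : hom X Z).
Proof. exact: (linear_bigsum f (@lcomp_linearr k C X Y Z g)). Qed.

Lemma comp0m X Y Z (f : hom X Y) : (0 : hom Y Z) \oc f = 0.
Proof.
have := comp_suml (fun i : void => 0 : hom Y Z) f.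
by rewrite !big_pred0 //; case.
Qed.

Lemma compm0 X Y Z (g : hom Y Z) : g \oc (0 : hom X Y) = 0.
Proof.
have := comp_sumr g (fun i : void => 0 : hom X Y).
by rewrite !big_pred0 //; case.
Qed.

Lemma tens_suml X Y X' Y' (K : finType) (f : K -> hom X Y) (g : hom X' Y') :
  (\sum_i f i : hom X Y) \om g = \sum_i (f i \om g : hom (X \ox X') (Y \ox Y')).
Proof. exact: (@linear_bigsum (lhom X Y) (lhom (X \ox X') (Y \ox Y')) _ _ _ (@mr_tens_linearl k C X Y X' Y' g)). Qed.

Lemma tens_sumr X Y X' Y' (K : finType) (f : hom X Y) (g : K -> hom X' Y') :
  f \om (\sum_i g i : hom X' Y') = \sum_i (f \om g i : hom (X \ox X') (Y \ox Y')).
Proof. exact: (@linear_bigsum (lhom X' Y') (lhom (X \ox X') (Y \ox Y')) _ _ _ (@mr_tens_linearr k C X Y X' Y' f)). Qed.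

Lemma tens0m X Y X' Y' (g : hom X' Y') :
  (0 : hom X Y) \om g = (0 : hom (X \ox X') (Y \ox Y')).
Proof.
have := tens_suml (fun i : void => 0 : hom X Y) g.
by rewrite !big_pred0 //; case.
Qed.

Lemma tensm0 X Y X' Y' (f : hom X Y) :
  f \om (0 : hom X' Y') = (0 : hom (X \ox X') (Y \ox Y')).
Proof.
have := tens_sumr f (fun i : void => 0 : hom X' Y').
by rewrite !big_pred0 //; case.
Qed.

End Bilinearity.

(* A decomposition of the unit into simple objects.  That the summands are
   pairwise non-isomorphic and that [1_i \ox 1_j = 0] for [i != j] follows: see
   [ud_noniso] and [ud_tens0]. *)
Record unit_decomposition (k : fieldType) (C : multiring_category k)
    (I : finType) := UnitDecomposition {
  ud_ob :> I -> C;
  ud_biproduct : @biproduct k C I ud_ob \1;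
  ud_simple : forall i, simple (ud_ob i) }.

Section Corner.
Variables (k : fieldType) (C : multiring_category k) (I : finType).
Variable one : unit_decomposition C I.

(* [X_ij = 1_i \ox X \ox 1_j] *)
Definition component (X : C) (i j : I) : C := (one i \ox X) \ox one j.

Definition diagonal_support (X : C) : {set I} :=
  [set i | `[< ~ zero_object (component X i i) >]].

Variable J : {set I}.

(* [X] is a direct sum of objects [1_i \ox Y_ij \ox 1_j], for [i, j] in [J]. *)
Definition in_corner (X : C) : Prop :=
  exists Y : I -> I -> C,
    inhabited (@biproduct k C ({i : I | i \in J} * {j : I | j \in J})%type
      (fun ij => component (Y (val ij.1) (val ij.2)) (val ij.1) (val ij.2)) X).

Variables (oneJ : C)
  (bJ : @biproduct k C {i : I | i \in J} (fun i => one (val i)) oneJ).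

Definition inclJ : hom oneJ \1 :=
  \sum_i (bin (ud_biproduct one) (val i) \oc bpr bJ i : hom oneJ \1).

Definition projJ : hom \1 oneJ :=
  \sum_i (bin bJ i \oc bpr (ud_biproduct one) (val i) : hom \1 oneJ).

Let eJ : hom \1 \1 := inclJ \oc projJ.

Lemma projJK : projJ \oc inclJ = idm oneJ.
Proof.
rewrite comp_suml -(bsum bJ); apply: eq_bigr => i _.
rewrite comp_sumr (bigD1 i) //= big1 ?addr0 => [|j ji].
  by rewrite -compA (compA (bpr _ _)) bprK comp1m.
by rewrite -compA (compA (bpr _ _)) bpr0 ?comp0m ?compm0 // (inj_eq val_inj).
Qed.

Lemma inclJ_mono : mono inclJ.
Proof.
move=> Z g h /(congr1 (comp projJ)).
by rewrite !compA projJK !comp1m.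
Qed.

Lemma bin_mono (K : finType) (X : K -> C) (S : C) (b : @biproduct k C K X S) i :
  mono (bin b i : hom (X i) S).
Proof.
move=> Z g h /(congr1 (comp (bpr b i))).
by rewrite !compA !bprK !comp1m.
Qed.

Lemma projJ_bin (i : {i | i \in J}) :
  projJ \oc bin (ud_biproduct one) (val i) = bin bJ i.
Proof.
rewrite comp_suml (bigD1 i) //= big1 ?addr0 => [|j ji].
  by rewrite -compA bprK compm1.
by rewrite -compA bpr0 ?compm0 // (inj_eq val_inj) eq_sym.
Qed.

Lemma inclJ_bin (i : {i | i \in J}) :
  inclJ \oc bin bJ i = bin (ud_biproduct one) (val i).
Proof.
rewrite comp_suml (bigD1 i) //= big1 ?addr0 => [|j ji].
  by rewrite -compA (bprK bJ) compm1.
by rewrite -compA (bpr0 bJ) ?compm0 // eq_sym.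
Qed.

Lemma eJ_sum :
  eJ = \sum_(i : {i | i \in J})
     (bin (ud_biproduct one) (val i) \oc bpr (ud_biproduct one) (val i) : hom \1 \1).
Proof.
rewrite /eJ [X in _ \oc X]/projJ comp_sumr; apply: eq_bigr => i _.
by rewrite compA inclJ_bin.
Qed.

Lemma eJ_bin (i : {i | i \in J}) :
  eJ \oc bin (ud_biproduct one) (val i) = bin (ud_biproduct one) (val i).
Proof. by rewrite /eJ -compA projJ_bin inclJ_bin. Qed.

Definition left_fixed (X : C) : Prop := \l_X \oc (eJ \om idm X) = \l_X.
Definition right_fixed (X : C) : Prop := \r_X \oc (idm X \om eJ) = \r_X.

Let sC := mr_strict C.

Lemma lunit1 : \l_(\1 : C) = \r_(\1 : C).
Proof.
apply: arr_inj; rewrite (lunitE sC) (runitE sC) !arr_cast.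
by congr (arr (idm _)).
Qed.

Lemma lunit_tens (X Y : C) : \l_(X \ox Y) \oc \a_(\1, X, Y) = \l_X \om idm Y.
Proof.
apply: arr_inj; rewrite arr_lunitl // (assocE sC) arr_cast.
rewrite [RHS]arr_tens (lunitE sC) arr_cast -!arr_idm_tens //.
Qed.

Lemma fixed_unit (Z : C) (f : hom Z \1) :
  mono f -> eJ \oc f = f -> left_fixed Z /\ right_fixed Z.
Proof.
move=> mf ef; split; apply: mf.
  rewrite compA -lunit_nat -compA -tensmM comp1m compm1.
  rewrite -[eJ in LHS]compm1 -[f in LHS]comp1m tensmM compA lunit1.
  rewrite runit_nat -lunit1 -compA !lunit_nat compA ef.
  by [].
rewrite compA -runit_nat -compA -tensmM comp1m compm1.
rewrite -[eJ in LHS]compm1 -[f in LHS]comp1m tensmM compA -lunit1.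
rewrite lunit_nat lunit1 -compA !runit_nat compA ef.
by [].
Qed.

Lemma left_fixed_tens (X Y : C) : left_fixed X -> left_fixed (X \ox Y).
Proof.
rewrite /left_fixed => fX; apply: (iso_epi (assoc_iso \1 X Y)).
rewrite -tensm1 -compA -assoc_nat compA lunit_tens -tensmM fX comp1m.
by [].
Qed.

Lemma right_fixed_tens (X Y : C) : right_fixed Y -> right_fixed (X \ox Y).
Proof.
rewrite /right_fixed -!runit_tens => fX.
by rewrite -tensm1 -compA assoc_nat compA -tensmM fX comp1m.
Qed.

Lemma left_fixed_biproduct (K : finType) (X : K -> C) (S : C) :
  @biproduct k C K X S -> (forall i, left_fixed (X i)) -> left_fixed S.
Proof.
move=> b fX; rewrite /left_fixed -[idm S](bsum b) tens_sumr comp_sumr.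
rewrite -[RHS]comp1m -[idm S in RHS](bsum b) comp_suml; apply: eq_bigr => i _.
have -> : eJ \om (bin b i \oc bpr b i : hom S S)
    = (idm \1 \om bin b i) \oc (eJ \om idm (X i)) \oc (idm \1 \om bpr b i).
  by rewrite -!tensmM !(comp1m, compm1).
by rewrite !compA lunit_nat -[in LHS](compA (bin b i)) fX -[in LHS]compA lunit_nat compA.
Qed.

Lemma right_fixed_biproduct (K : finType) (X : K -> C) (S : C) :
  @biproduct k C K X S -> (forall i, right_fixed (X i)) -> right_fixed S.
Proof.
move=> b fX; rewrite /right_fixed -[idm S](bsum b) tens_suml comp_sumr.
rewrite -[RHS]comp1m -[idm S in RHS](bsum b) comp_suml; apply: eq_bigr => i _.
have -> : (bin b i \oc bpr b i : hom S S) \om eJ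
    = (bin b i \om idm \1) \oc (idm (X i) \om eJ) \oc (bpr b i \om idm \1).
  by rewrite -!tensmM !(comp1m, compm1).
by rewrite !compA runit_nat -[in LHS](compA (bin b i)) fX -[in LHS]compA runit_nat compA.
Qed.

Lemma in_corner_fixed (X : C) :
  in_corner X <-> left_fixed X /\ right_fixed X.
Proof.
split=> [[Y [b]]|[lX rX]].
  have fone (i : {i | i \in J}) := fixed_unit (@bin_mono _ _ _ (ud_biproduct one) (val i)) (eJ_bin i).
  split.
    apply: (left_fixed_biproduct b) => ij; do 2!apply: left_fixed_tens.
    by case: (fone ij.1).
  apply: (right_fixed_biproduct b) => ij; apply: right_fixed_tens.
  by case: (fone ij.2).
exists (fun _ _ => X); split; set u := ud_biproduct one.
pose f (ij : {i | i \in J} * {j | j \in J}) :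
    hom (component X (val ij.1) (val ij.2)) X :=
  \r_X \oc ((\l_X \oc (bin u (val ij.1) \om idm X)) \om bin u (val ij.2)).
pose g (ij : {i | i \in J} * {j | j \in J}) :
    hom X (component X (val ij.1) (val ij.2)) :=
  (((bpr u (val ij.1) \om idm X) \oc lunitV (mstr C) X) \om bpr u (val ij.2))
    \oc runitV (mstr C) X.
have gf ij kl : g kl \oc f ij =
    ((bpr u (val kl.1) \oc bin u (val ij.1)) \om idm X)
      \om (bpr u (val kl.2) \oc bin u (val ij.2)).
  rewrite /f /g -compA (compA (runitV _ _)) runitKV comp1m -tensmM.
  by rewrite -(compA (_ \om idm X)) (compA (lunitV _ _)) lunitKV comp1m -tensmM comp1m.
exists f g => [ij|ij kl neq|].
- by rewrite gf !bprK !tensm1.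
- rewrite gf; case: (eqVneq ij.1 kl.1) => [e1|ne1].
    rewrite [X in _ \om X](bpr0 u) ?tensm0 //.
    apply: contra neq => /eqP/val_inj e2; apply/eqP.
    by rewrite [ij]surjective_pairing e1 e2 -surjective_pairing.
  by rewrite (bpr0 u (i := val ij.1)) ?tens0m // (inj_eq val_inj).
have fg ij : f ij \oc g ij = \r_X \oc ((\l_X \oc ((bin u (val ij.1) \oc bpr u (val ij.1)) \om idm X)
   \oc lunitV (mstr C) X) \om (bin u (val ij.2) \oc bpr u (val ij.2))) \oc runitV (mstr C) X.
  rewrite /f /g compA -[in LHS](compA \r_X) -tensmM compA -[in LHS](compA \l_X) -tensmM comp1m.
  by [].
rewrite (eq_bigr _ (fun ij _ => fg ij)).
have eX : idm X = \r_X \oc ((\l_X \oc (eJ \om idm X) \oc lunitV (mstr C) X) \om eJ)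
    \oc runitV (mstr C) X.
  by rewrite lX lunitVK rX runitVK.
rewrite [RHS]eX.
rewrite [in X in X \om eJ]eJ_sum tens_suml comp_sumr comp_suml tens_suml comp_sumr.
rewrite comp_suml.
under [RHS]eq_bigr do rewrite eJ_sum tens_sumr comp_sumr comp_suml.
by rewrite pair_bigA.
Qed.

Definition corner_category : category := full_subcategory in_corner.

Lemma corner_tens (X Y : C) : in_corner X -> in_corner Y -> in_corner (X \ox Y).
Proof.
move=> /in_corner_fixed[lX _] /in_corner_fixed[_ rY].
apply/in_corner_fixed; split; first exact: left_fixed_tens.
exact: right_fixed_tens.
Qed.

Lemma corner_unit : in_corner oneJ.
Proof.
apply/in_corner_fixed; apply: (fixed_unit inclJ_mono).
by rewrite /eJ -compA projJK compm1.
Qed.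

Lemma corner_lunitVK (X : C) : in_corner X ->
  (\l_X \oc (inclJ \om idm X)) \oc ((projJ \om idm X) \oc lunitV (mstr C) X) = idm X.
Proof.
move=> /in_corner_fixed[lX _].
by rewrite compA -(compA \l_X) -tensmM comp1m lX lunitVK.
Qed.

Lemma corner_lunitKV (X : C) :
  ((projJ \om idm X) \oc lunitV (mstr C) X) \oc (\l_X \oc (inclJ \om idm X))
  = idm (oneJ \ox X).
Proof.
rewrite -compA (compA (lunitV _ _)) lunitKV comp1m -tensmM projJK comp1m.
by rewrite tensm1.
Qed.

Lemma corner_runitVK (X : C) : in_corner X ->
  (\r_X \oc (idm X \om inclJ)) \oc ((idm X \om projJ) \oc runitV (mstr C) X) = idm X.
Proof.
move=> /in_corner_fixed[_ rX].
by rewrite compA -(compA \r_X) -tensmM comp1m rX runitVK.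
Qed.

Lemma corner_runitKV (X : C) :
  ((idm X \om projJ) \oc runitV (mstr C) X) \oc (\r_X \oc (idm X \om inclJ))
  = idm (X \ox oneJ).
Proof.
rewrite -compA (compA (runitV _ _)) runitKV comp1m -tensmM projJK comp1m.
by rewrite tensm1.
Qed.

Lemma corner_lunit_nat (X Y : C) (f : hom X Y) :
  (\l_Y \oc (inclJ \om idm Y)) \oc (idm oneJ \om f)
  = f \oc (\l_X \oc (inclJ \om idm X)).
Proof.
by rewrite -compA -tensmM !compA -lunit_nat -compA -tensmM !(comp1m, compm1).
Qed.

Lemma corner_runit_nat (X Y : C) (f : hom X Y) :
  (\r_Y \oc (idm Y \om inclJ)) \oc (f \om idm oneJ)
  = f \oc (\r_X \oc (idm X \om inclJ)).
Proof.
by rewrite -compA -tensmM !compA -runit_nat -compA -tensmM !(comp1m, compm1).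
Qed.

Lemma corner_triangle (X Y : C) :
  (idm X \om (\l_Y \oc (inclJ \om idm Y))) \oc \a_(X, oneJ, Y)
  = (\r_X \oc (idm X \om inclJ)) \om idm Y.
Proof.
by rewrite tensmDr -compA -assoc_nat compA triangle tensmDl.
Qed.

(* The unit constraints are [i_J \ox X] and [X \ox i_J], with values in
   [\1 \ox X = X] and [X \ox \1 = X]. *)
Definition corner_structure : monoidal_structure corner_category :=
  @MonoidalStructure corner_category
    (fun X Y => exist _ (sval X \ox sval Y) (corner_tens (svalP X) (svalP Y)))
    (fun X Y X' Y' f g => f \om g)
    (exist _ oneJ corner_unit)
    (fun X Y Z => \a_(sval X, sval Y, sval Z))
    (fun X Y Z => assocV (mstr C) (sval X) (sval Y) (sval Z))
    (fun X => \l_(sval X) \oc (inclJ \om idm (sval X)))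
    (fun X => (projJ \om idm (sval X)) \oc lunitV (mstr C) (sval X))
    (fun X => \r_(sval X) \oc (idm (sval X) \om inclJ))
    (fun X => (idm (sval X) \om projJ) \oc runitV (mstr C) (sval X))
    (fun X Y => tensm1 (mstr C) (sval X) (sval Y))
    (fun X Y Z X' Y' Z' g f g' f' => tensmM (mstr C) g f g' f')
    (fun X Y Z => assocVK (mstr C) (sval X) (sval Y) (sval Z))
    (fun X Y Z => assocKV (mstr C) (sval X) (sval Y) (sval Z))
    (fun X => corner_lunitVK (svalP X))
    (fun X => corner_lunitKV (sval X))
    (fun X => corner_runitVK (svalP X))
    (fun X => corner_runitKV (sval X))
    (fun X X' Y Y' Z Z' f g h => assoc_nat (mstr C) f g h)
    (fun X Y f => corner_lunit_nat f)
    (fun X Y f => corner_runit_nat f)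
    (fun X Y Z W => pentagon (mstr C) (sval X) (sval Y) (sval Z) (sval W))
    (fun X Y => corner_triangle (sval X) (sval Y)).

(* The monoidal category [C_J]. *)
Definition corner : monoidal_category := MonoidalCategory corner_structure.

Variable A : algebra C.

Let AJ : C := (oneJ \ox A) \ox oneJ.

Lemma corner_alg_ob_proof : in_corner AJ.
Proof.
have /in_corner_fixed[l1 r1] := corner_unit.
apply/in_corner_fixed; split; last exact: right_fixed_tens.
by do 2!apply: left_fixed_tens.
Qed.

Lemma corner_mul_dom : AJ \ox AJ = ((oneJ \ox A) \ox (oneJ \ox oneJ)) \ox (A \ox oneJ).
Proof. by rewrite /AJ !(tensA sC). Qed.

Lemma corner_mul_mid :
  ((oneJ \ox A) \ox (\1 \ox \1)) \ox (A \ox oneJ) = (oneJ \ox (A \ox A)) \ox oneJ.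
Proof. by rewrite (tens1X sC) (tensX1 sC) !(tensA sC). Qed.

Lemma corner_unit_dom : oneJ = (oneJ \ox \1) \ox \1.
Proof. by rewrite !(tensX1 sC). Qed.

(* In [corner_mul] and [corner_alg_unit], [cast] only rebrackets and removes or
   inserts units, both of which are identities in a strict category. *)
Definition corner_mul : hom (AJ \ox AJ) AJ :=
  ((idm oneJ \om alg_mul A) \om idm oneJ)
    \oc cast corner_mul_mid
    \oc ((idm (oneJ \ox A) \om (inclJ \om inclJ)) \om idm (A \ox oneJ))
    \oc cast corner_mul_dom.

Definition corner_alg_unit : hom oneJ AJ :=
  ((idm oneJ \om alg_unit A) \om idm oneJ)
    \oc ((idm oneJ \om idm \1) \om projJ)
    \oc cast corner_unit_dom.

Let alpha : hom (oneJ \ox oneJ) \1 := \l_\1 \oc (inclJ \om inclJ).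
Let lam : hom ((oneJ \ox oneJ) \ox A) A := \l_(alg_ob A) \oc (alpha \om idm A).
Let mu : hom (A \ox ((oneJ \ox oneJ) \ox A)) A := alg_mul A \oc (idm A \om lam).

Notation "a \at b" := (atens a b) (at level 40, left associativity).

Lemma arr_lam : arr lam = arr (inclJ) \at arr inclJ \at arr (idm A).
Proof.
rewrite /lam /alpha (arr_lunitl sC) arr_tens (arr_lunitl sC).
by rewrite arr_tens.
Qed.

Lemma arr_corner_mul :
  arr corner_mul = arr (idm oneJ) \at arr mu \at arr (idm oneJ).
Proof.
rewrite /corner_mul arr_castr.
transitivity (arr (((idm oneJ \om alg_mul A) \om idm oneJ) \oc ((idm oneJ \om (idm A \om lam)) \om idm oneJ))).
  rewrite -compA; apply: arr_comp => //.
  rewrite arr_castl !arr_tens arr_lam !(arr_idm_tens) !(atensA sC).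
  by [].
by rewrite -!tensmM !comp1m.
Qed.

Let wrap (X Y : C) (f : hom X Y) := (idm oneJ \om f) \om idm oneJ.

Lemma wrap_comp (X Y Z : C) (g : hom Y Z) (f : hom X Y) :
  wrap (g \oc f) = wrap g \oc wrap f.
Proof. by rewrite /wrap -!tensmM !comp1m. Qed.

Lemma arr_wrap (X Y : C) (f : hom X Y) :
  arr (wrap f) = arr (idm oneJ) \at arr f \at arr (idm oneJ).
Proof. by []. Qed.

Lemma arr_wrap_eq (X Y X' Y' : C) (f : hom X Y) (f' : hom X' Y') :
  arr f = arr f' -> arr (wrap f) = arr (wrap f').
Proof. by rewrite !arr_wrap => ->. Qed.

Lemma arr_alg_unit :
  arr corner_alg_unit = arr (idm oneJ) \at arr (alg_unit A) \at arr projJ.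
Proof.
by rewrite /corner_alg_unit arr_castr tensm1 -tensmM comp1m compm1.
Qed.

Lemma corner_mulA :
  corner_mul \oc (corner_mul \om idm AJ)
  = corner_mul \oc (idm AJ \om corner_mul) \oc \a_(AJ, AJ, AJ).
Proof.
apply: arr_inj; rewrite (arr_assocr sC).
pose W := (oneJ \ox oneJ) \ox A.
transitivity (arr (wrap mu \oc wrap (mu \om idm W))).
  apply: arr_comp; first by rewrite arr_corner_mul.
  rewrite arr_wrap !arr_tens arr_corner_mul !arr_idm_tens !(atensA sC).
  by [].
transitivity (arr (wrap mu \oc wrap (idm A \om (idm (oneJ \ox oneJ) \om mu)))); last first.
  apply: arr_comp; first by rewrite arr_corner_mul.
  rewrite arr_wrap !arr_tens arr_corner_mul !arr_idm_tens !(atensA sC).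
  by [].
rewrite -!wrap_comp; apply: arr_wrap_eq.
have -> : mu \oc (mu \om idm W)
    = alg_mul A \oc (idm A \om alg_mul A) \oc (idm A \om (lam \om lam))
        \oc \a_(alg_ob A, W, W).
  rewrite -[RHS]compA -assoc_nat [RHS]compA -alg_mulA /mu.
  by rewrite -!compA -!tensmM !(comp1m, compm1).
rewrite (arr_assocr sC) /mu -!compA; apply: arr_comp => //.
rewrite -!tensmM !comp1m !arr_tens; congr (_ \at _).
have -> : lam \oc (idm (oneJ \ox oneJ) \om mu)
    = alg_mul A \oc (idm A \om lam) \oc (\l_(alg_ob A \ox W) \oc (alpha \om idm _)).
  rewrite -/mu [in LHS]/lam -[in LHS]compA -tensmM comp1m compm1 [RHS]compA -lunit_nat.
  by rewrite -[RHS]compA -tensmM comp1m compm1.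
rewrite -[X in _ = arr X]compA; apply: arr_comp => //.
transitivity (arr ((idm A \om lam) \oc (lam \om idm W))).
  by rewrite -tensmM comp1m compm1.
apply: arr_comp => //; rewrite (arr_lunitl sC) !arr_tens (arr_lunitl sC) arr_tens.
by rewrite !arr_idm_tens !(atensA sC).
Qed.

Lemma inclJ_swap : arr (idm oneJ) \at arr inclJ = arr inclJ \at arr (idm oneJ).
Proof.
rewrite -!arr_tens -(arr_runitl sC) -[RHS](arr_lunitl sC); congr arr.
apply: inclJ_mono; rewrite !compA -runit_nat -lunit_nat -!compA -!tensmM.
by rewrite !comp1m !compm1 lunit1.
Qed.

Lemma corner_mul1m :
  corner_mul \oc (corner_alg_unit \om idm AJ) = \l_AJ \oc (inclJ \om idm AJ).
Proof.
apply: arr_inj; rewrite (arr_lunitl sC).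
transitivity (arr (wrap mu \oc wrap (alg_unit A \om ((projJ \om idm oneJ) \om idm A)))).
  apply: arr_comp; first by rewrite arr_corner_mul.
  by rewrite arr_wrap !arr_tens arr_alg_unit !arr_idm_tens !(atensA sC).
rewrite -wrap_comp; transitivity (arr (wrap (inclJ \om idm A))); last first.
  by rewrite arr_wrap !arr_tens !arr_idm_tens !(atensA sC) inclJ_swap.
apply: arr_wrap_eq; rewrite /mu -compA -tensmM comp1m.
set v := lam \oc _.
have -> : alg_unit A \om v = (alg_unit A \om idm A) \oc (idm \1 \om v).
  by rewrite -tensmM comp1m compm1.
rewrite compA alg_mul1m.
rewrite (arr_lunitl sC) arr_tens (atens1x sC).
rewrite /v /lam -compA (arr_lunitl sC) -tensmM comp1m !arr_tens; congr (_ \at _).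
rewrite /alpha -compA -tensmM compm1.
have -> : (inclJ \oc projJ) \om inclJ = (idm \1 \om inclJ) \oc (eJ \om idm oneJ).
  by rewrite -tensmM comp1m compm1.
rewrite compA lunit_nat -compA.
have /in_corner_fixed[-> _] := corner_unit.
by rewrite (arr_lunitr sC).
Qed.

Lemma corner_mulm1 :
  corner_mul \oc (idm AJ \om corner_alg_unit) = \r_AJ \oc (idm AJ \om inclJ).
Proof.
apply: arr_inj; rewrite (arr_runitl sC).
transitivity (arr (wrap mu \oc
    ((idm oneJ \om (idm A \om (idm (oneJ \ox oneJ) \om alg_unit A))) \om projJ))).
  apply: arr_comp; first by rewrite arr_corner_mul.
  by rewrite !arr_tens arr_alg_unit !arr_idm_tens !(atensA sC).
have ip : arr inclJ \at arr projJ = arr (idm oneJ).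
  rewrite -projJK -arr_tens -[inclJ in LHS]comp1m -[projJ in LHS]compm1 tensmM.
  apply: arr_comp; first by rewrite arr_tens (atens1x sC).
  by rewrite arr_tens (atensx1 sC).
rewrite -!tensmM !comp1m /mu.
have -> : alg_mul A \oc (idm A \om lam) \oc (idm A \om (idm (oneJ \ox oneJ) \om alg_unit A))
    = \r_(alg_ob A) \oc (idm A \om (\l_\1 \oc (alpha \om idm \1))).
  rewrite -compA -tensmDr -alg_mulm1 -[RHS]compA -tensmDr /lam.
  by rewrite compA -lunit_nat -!compA -!tensmM !(comp1m, compm1).
rewrite !arr_tens (arr_runitl sC) arr_tens (arr_lunitl sC) arr_tens (atensx1 sC).
rewrite (arr_lunitl sC) arr_tens !arr_idm_tens.
by rewrite -!(atensA sC) ip inclJ_swap !(atensA sC).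
Qed.

(* The algebra [A_J = 1_J \ox A \ox 1_J] of [C_J]. *)
Definition corner_algebra : algebra corner :=
  @Algebra corner (exist _ AJ corner_alg_ob_proof) corner_mul corner_alg_unit
    corner_mulA corner_mul1m corner_mulm1.

End Corner.

Section UnitDecompositionTheory.
Variables (k : fieldType) (C : multiring_category k) (I : finType).
Variable one : unit_decomposition C I.

Let e i : hom \1 \1 := bin (ud_biproduct one) i \oc bpr (ud_biproduct one) i.

Lemma lunit_tens_e i j : \l_\1 \oc (e i \om e j) = e i \oc e j \oc \l_\1.
Proof.
have -> : e i \om e j = (e i \om idm \1) \oc (idm \1 \om e j).
  by rewrite -tensmM comp1m compm1.
by rewrite compA {1}lunit1 runit_nat -lunit1 -!compA lunit_nat /e -!compA.
Qed.

Lemma zero_objectP (X : C) : idm X = (0 : hom X X) -> zero_object X.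
Proof.
move=> X0; split=> Y f.
  by rewrite -[f]compm1 X0 compm0.
by rewrite -[f]comp1m X0 comp0m.
Qed.

Lemma ud_tens0 i j : i != j -> zero_object (one i \ox one j).
Proof.
move=> ij; apply: zero_objectP; set u := ud_biproduct one.
pose o : C := \1.
have e0 : e i \om e j = (0 : hom (o \ox o) (o \ox o)).
  rewrite -[e i \om e j]comp1m -(lunitKV (mstr C)) -compA lunit_tens_e.
  rewrite /e -!compA (compA (bpr u i)) (bpr0 u) 1?eq_sym //.
  by rewrite comp0m !compm0.
rewrite -tensm1 -(bprK u i) -(bprK u j).
have -> : (bpr u i \oc bin u i) \om (bpr u j \oc bin u j)
    = (bpr u i \om bpr u j) \oc (e i \om e j) \oc (bin u i \om bin u j).
  by rewrite -!tensmM /e -!compA !bprK !compm1 !bprK.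
by rewrite e0 compm0 comp0m.
Qed.

Lemma ud_noniso i j (f : hom (one i) (one j)) : is_iso f -> i = j.
Proof.
case=> g [gf _]; apply/eqP; apply: contraT => ij; set u := ud_biproduct one.
have [z0 _] := ud_tens0 ij.
have id0 : idm (one i \ox one i) = (0 : hom (one i \ox one i) (one i \ox one i)).
  rewrite -tensm1 -[X in _ \om X]gf tensmDr.
  by rewrite (z0 _ (idm (one i) \om g)) comp0m.
have e0 : e i = 0.
  have ee : e i \oc e i = e i by rewrite /e compA -(compA _ (bpr _ i)) bprK compm1.
  rewrite -[e i]compm1 -(lunitVK (mstr C)) -ee compA -lunit_tens_e.
  rewrite /e tensmM -[bin u i \om _]compm1 id0 compm0 comp0m compm0.
  by rewrite comp0m.
case: (ud_simple one i) => nz _; case: nz; apply: zero_objectP.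
have -> : idm (one i) = bpr u i \oc e i \oc bin u i.
  by rewrite /e -!compA !bprK compm1 bprK.
by rewrite e0 compm0 comp0m.
Qed.

End UnitDecompositionTheory.

(* Main.v *)
From mathcomp Require Import all_boot all_algebra.
Require Import Defs.

Set Implicit Arguments.
Unset Strict Implicit.
Unset Printing Implicit Defensive.

Import GRing.Theory.
Local Open Scope ring_scope.
Local Open Scope cat_scope.

(** A functor [- \ox B] is separable as soon as the unit [1 -> B] is a split
    monomorphism: a retraction [p] of it turns a module morphism
    [h : M \ox B -> N \ox B] into [(N \ox p) h (M \ox u_B) : M -> N], which is
    natural in [M] and [N] and sends [f \ox B] to [f]
    ([separable_of_unit_retraction]).

    It remains to retract [1_J -> A_J].  The map [i_J \ox A \ox i_J] from [A_J]
    to [A] sends the unit of [A_J] to the restriction [u_A i_J] of the unit of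
    [A] ([corner_forget_unit]), so it suffices to retract
    [u_A i_J : 1_J -> A].  Its component on [1_i] is nonzero for [i] in [J]:
    otherwise [1_i] would act by zero on [A], although it acts as the identity
    on [A_ii <> 0] ([unit_component_neq0]).  Since [A] is a direct sum of simple
    objects, Schur's lemma inverts one coordinate of this component and gives
    [q_i : A -> 1_i] with [q_i u_A = id] on [1_i]
    ([simple_retraction]).  On the other summands [1_j] the morphism
    [q_i u_A : 1_j -> 1_i] is zero, again by Schur, because [1_i] and [1_j] are
    not isomorphic.  Hence the [q_i] together form the retraction. *)

(** * Separability from a retraction of the unit *)

Lemma separable_of_unit_retraction (E : monoidal_category) (B : algebra E)
    (p : hom (B : E) \1) :
  p \oc alg_unit B = idm \1 -> separable (free_module_functor B).
Proof.
move=> pu.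
exists (fun M N h => \r_N \oc (idm N \om p) \oc sval h
  \oc (idm M \om alg_unit B) \oc runitV (mstr E) M); split=> [X X' Y Y' f h g|X Y f].
  have p_nat : \r_Y' \oc (idm Y' \om p) \oc (g \om idm (B : E))
      = g \oc (\r_Y \oc (idm Y \om p)).
    rewrite compA -runit_nat -!compA -!tensmM.
    by rewrite !(comp1m, compm1).
  have u_nat : (f \om idm (B : E)) \oc ((idm X' \om alg_unit B) \oc runitV (mstr E) X')
      = (idm X \om alg_unit B) \oc runitV (mstr E) X \oc f.
    have rV : (f \om idm \1) \oc runitV (mstr E) X' = runitV (mstr E) X \oc f.
      rewrite -[LHS]comp1m -(runitKV (mstr E)) -!compA; congr (_ \oc _).
      by rewrite compA runit_nat -compA runitVK compm1.
    by rewrite -compA -rV !compA -!tensmM !(comp1m, compm1).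
  by rewrite /= !compA p_nat -!compA u_nat -!compA.
rewrite /= -(compA \r_Y) -tensmM -(compA \r_Y) -tensmM !(comp1m, compm1) pu.
rewrite runit_nat.
by rewrite -compA runitVK compm1.
Qed.

(** * Schur's lemma and retractions onto simple objects *)

Section Schur.
Variables (k : fieldType) (C : multiring_category k).
Implicit Types X Y Z S : C.

Lemma mono_of_injective0 X Y (f : hom X Y) :
  (forall Z (g : hom Z X), f \oc g = (0 : hom Z Y) -> g = (0 : hom Z X)) -> mono f.
Proof.
move=> f0 Z g h efg; apply/eqP; rewrite -subr_eq0; apply/eqP; apply: f0.
have := @lcomp_linearr k C Z X Y f (-1) h g.
rewrite /= !scaleN1r => fgh; rewrite [g - h]addrC; apply: etrans fgh _.
by rewrite [X in _ + X]efg addNr.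
Qed.

Lemma kernel_mono X Y Z (g : hom Y Z) (f : hom X Y) : is_kernel g f -> mono f.
Proof.
move=> [gf0 kerf] W a b eab.
have [|u [_ uniq_u]] := kerf W (f \oc b); first by rewrite compA gf0 comp0m.
by rewrite -(uniq_u a eab) (uniq_u b).
Qed.

Lemma simple_mono X Y (f : hom X Y) :
  simple X -> f <> (0 : hom X Y) -> mono f.
Proof.
move=> [_ simX] nzf; have [K [j kerj]] := ab_kernel (mr_abelian C) f.
have [fj0 lift_j] := kerj.
case: (simX _ _ (kernel_mono kerj)) => [[zK _]|[g [_ jg]]].
  apply: mono_of_injective0 => Z g /lift_j [u [<- _]].
  by rewrite (zK _ j) comp0m.
by case: nzf; rewrite -[f]compm1 -jg compA fj0 comp0m.
Qed.

Lemma schur X Y (f : hom X Y) :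
  simple X -> simple Y -> f <> (0 : hom X Y) -> is_iso f.
Proof.
move=> simX [_ simY] nzf.
case: (simY _ _ (simple_mono simX nzf)) => // zX.
by case: simX.
Qed.

(** Some coordinate of [f] in a decomposition of [Y] into simple objects is
    nonzero, and the inverse of this coordinate gives the retraction. *)
Lemma simple_retraction X Y (f : hom X Y) :
  semisimple C -> simple X -> f <> (0 : hom X Y) ->
  exists q : hom Y X, q \oc f = idm X.
Proof.
move=> ssC simX nzf; have [n [S [simS [b]]]] := ssC Y.
have [i nzi] : exists i, bpr b i \oc f <> (0 : hom X (S i)).
  apply: boolp.contrapT => none; apply: nzf.
  rewrite -[f]comp1m -(bsum b) comp_suml big1 // => i _.
  rewrite -compA; have -> : bpr b i \oc f = (0 : hom X (S i)).
    by apply: boolp.contrapT => nzi; apply: none; exists i.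
  exact: compm0.
have [g [gK _]] := schur simX (simS i) nzi.
by exists (g \oc bpr b i); rewrite -compA.
Qed.

End Schur.

(** * The unit of the corner algebra *)

Section CornerUnit.
Variables (k : fieldType) (C : multiring_category k) (I : finType).
Variables (one : unit_decomposition C I) (A : algebra C).

Let iota i : hom (one i) \1 := bin (ud_biproduct one) i.

(** The morphism [1_i \ox A -> \1 \ox A = A] is a split monomorphism, and it is
    also multiplication by [u_A] restricted to [1_i]. *)
Lemma unit_component_neq0 i :
  i \in diagonal_support one A ->
  alg_unit A \oc iota i <> (0 : hom (one i) A).
Proof.
rewrite inE => /boolp.asboolP nz u0; apply: nz; apply: zero_objectP.
have l0 : \l_(alg_ob A) \oc (iota i \om idm (A : C)) = (0 : hom (one i \ox A) A).
  rewrite -alg_mul1m -compA -tensmM comp1m u0 tens0m.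
  exact: compm0.
have id0 : idm (one i \ox A) = (0 : hom (one i \ox A) (one i \ox A)).
  rewrite -tensm1 -(bprK (ud_biproduct one) i) -[X in _ \om X]comp1m tensmM.
  rewrite -/(iota i) -[iota i \om _]comp1m -(lunitKV (mstr C)) -(compA _ \l__) l0.
  by rewrite !compm0.
by rewrite -tensm1 id0 tens0m.
Qed.

Variables (J : {set I}) (oneJ : C)
  (bJ : @biproduct k C {i : I | i \in J} (fun i => one (val i)) oneJ).

Definition corner_forget : hom ((oneJ \ox A) \ox oneJ) A :=
  \r_(alg_ob A) \oc ((\l_(alg_ob A) \oc (inclJ bJ \om idm (A : C))) \om inclJ bJ).

(** The factor [p_J] in the unit of [A_J] meets a factor [i_J] of
    [corner_forget]; the idempotent [i_J p_J] of the unit slides through the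
    unitors onto the other [i_J], which absorbs it since [p_J i_J = id].  The
    unitors left over at the source are identities by strictness. *)
Lemma corner_forget_unit :
  corner_forget \oc corner_alg_unit bJ A = alg_unit A \oc inclJ bJ.
Proof.
have sC := mr_strict C.
apply: arr_inj.
transitivity (arr (corner_forget \oc ((idm oneJ \om alg_unit A) \om projJ bJ))).
  by apply: arr_comp => //; exact: arr_alg_unit.
have -> : corner_forget \oc ((idm oneJ \om alg_unit A) \om projJ bJ)
    = alg_unit A \oc inclJ bJ \oc \r_oneJ \oc \r_(oneJ \ox \1).
  have left_part : \l_(alg_ob A) \oc (inclJ bJ \om alg_unit A)
      = alg_unit A \oc (inclJ bJ \oc \r_oneJ).
    rewrite -[inclJ bJ in LHS]comp1m -[alg_unit A in LHS]compm1 tensmM compA.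
    by rewrite lunit_nat lunit1 -compA runit_nat.
  rewrite /corner_forget -compA -tensmM -compA -tensmM comp1m compm1 left_part.
  set w := inclJ bJ \oc \r_oneJ.
  rewrite -[alg_unit A \oc w]compm1.
  have -> : (alg_unit A \oc w \oc idm _) \om (inclJ bJ \oc projJ bJ)
      = (alg_unit A \om idm \1) \oc (idm \1 \om (inclJ bJ \oc projJ bJ))
          \oc (w \om idm \1).
    by rewrite -!tensmM !(comp1m, compm1).
  rewrite !compA runit_nat -lunit1 -!compA (compA \l__) lunit_nat -!compA.
  rewrite lunit1 runit_nat /w !compA -(compA (alg_unit A \oc inclJ bJ)) projJK compm1.
  by [].
by rewrite !(arr_runitr sC).
Qed.

End CornerUnit.

Theorem proposition5p15 (k : closedFieldType) (C : multiring_category k)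
  (semisimpleC : semisimple C) (dualsC : has_left_duals C)
  (I : finType) (one : unit_decomposition C I) (A : algebra C)
  (oneJ : C)
  (bJ : biproduct
          (fun i : {i : I | i \in diagonal_support one A} => one (val i)) oneJ) :
  separable (free_module_functor (corner_algebra bJ A)).
Proof.
set u := ud_biproduct one.
have ex_q (i : {i | i \in diagonal_support one A}) :
    exists q : hom (A : C) (one (val i)), q \oc (alg_unit A \oc bin u (val i)) = idm _.
  apply: simple_retraction => //; first exact: ud_simple.
  exact/unit_component_neq0/(valP i).
have [q qK] := fin_all_exists ex_q.
have q0 (i j : {i | i \in diagonal_support one A}) : j != i ->
    q i \oc (alg_unit A \oc bin u (val j)) = (0 : hom (one (val j)) (one (val i))).
  move=> ji; apply: boolp.contrapT => nz.
  have := ud_noniso (schur (ud_simple one _) (ud_simple one _) nz).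
  by move/val_inj/eqP; apply/negP.
pose r : hom (A : C) oneJ := \sum_i (bin bJ i \oc q i : hom (A : C) oneJ).
have rK : r \oc (alg_unit A \oc inclJ bJ) = idm oneJ.
  rewrite /r comp_suml -(bsum bJ); apply: eq_bigr => i _.
  rewrite -!compA; congr (_ \oc _).
  rewrite /inclJ !comp_sumr (bigD1 i) //= big1 ?addr0 => [|j ji].
    by rewrite !compA -(compA (q i)) qK comp1m.
  by rewrite !compA -(compA (q i)) q0 // comp0m.
apply: (@separable_of_unit_retraction (corner bJ) (corner_algebra bJ A)
  (r \oc corner_forget A bJ)).
apply: etrans rK; rewrite -(corner_forget_unit A bJ).
by symmetry; exact: compA.
Qed.
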